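(* Let $\rho\in\mathbb R$ and let $(b,\sigma,\eta)$ satisfy assumption (A) of the context with Lipschitz constant $L_1$, and suppose $\rho>\ln(4L_1^2)$. Assume that the stochastic difference equation S$\triangle$E $(b,\sigma,\eta)$ $$x_{k+1}=b(k,x_k)+\sigma(k,x_k)w_k,\quad k\in\mathbb T_\infty,\qquad x_0=\eta,$$ admits a solution $x(\cdot)\in L^{2,\rho}_{\mathbb F}(\mathbb T_\infty;\mathbb R^n)$. Then there exists a constant $\mathcal C>0$, depending only on $L_1$ and $\rho$, such that $$\sum_{k=0}^\infty e^{-\rho k}\,\mathbb E\big[|x_k|^2\big]\le\mathcal C\,\mathbb E\Big[|\eta|^2+\sum_{k=0}^\infty e^{-\rho k}\big(|b(k,0)|^2+|\sigma(k,0)|^2\big)\Big].$$ Moreover, if $\bar x(\cdot)\in L^{2,\rho}_{\mathbb F}(\mathbb T_\infty;\mathbb R^n)$ is the solution of S$\triangle$E $(\bar b,\bar\sigma,\bar\eta)$, where $(\bar b,\bar\sigma,\bar\eta)$ satisfies the same assumptions (with the same $\rho$ and $L_1$), then $$\sum_{k=0}^\infty e^{-\rho k}\,\mathbb E\big[|x_k-\bar x_k|^2\big]\le\mathcal C\,\mathbb E\Big[|\eta-\bar\eta|^2+\sum_{k=0}^\infty e^{-\rho k}\big(|b(k,\bar x_k)-\bar b(k,\bar x_k)|^2+|\sigma(k,\bar x_k)-\bar\sigma(k,\bar x_k)|^2\big)\Big].$$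
   Context: $\mathbb T_\infty=\{0,1,2,\dots\}$. $(\Omega,\mathcal F,\mathbb F,\mathbb P)$ is a complete filtered probability space carrying a real-valued martingale difference sequence $\{w_k\}_{k\in\mathbb T_\infty}$; $\mathcal F_k$ is the $\sigma$-algebra generated by $x_0,w_0,\dots,w_k$ for $k\ge0$, $\mathcal F_{-1}=\{\emptyset,\Omega\}$ (so $x_0$ is deterministic), and $\mathbb E[w_{k+1}|\mathcal F_k]=0$, $\mathbb E[w_{k+1}^2|\mathcal F_k]=1$ for all $k\ge-1$. $L^{2,\rho}_{\mathbb F}(\mathbb T_\infty;\mathbb R^n)$ is the set of $\mathbb R^n$-valued processes $g=(g_0,g_1,\dots)$ with $g_k$ $\mathcal F_{k-1}$-measurable for every $k$ and $\mathbb E\sum_{k=0}^\infty e^{-\rho k}|g_k|^2<\infty$. $L^2_{\mathcal F_{-1}}(\Omega;\mathbb R^n)$ is the set of square-integrable $\mathcal F_{-1}$-measurable $\mathbb R^n$-valued random variables. Assumption (A): $\eta\in L^2_{\mathcal F_{-1}}(\Omega;\mathbb R^n)$ and $b,\sigma:\Omega\times\mathbb T_\infty\times\mathbb R^n\to\mathbb R^n$ satisfy: (i) $b(k,x)$ and $\sigma(k,x)$ are $\mathcal F_{k-1}$-measurable for every $x\in\mathbb R^n$, $k\in\mathbb T_\infty$; (ii) $b(\cdot,0),\sigma(\cdot,0)\in L^{2,\rho}_{\mathbb F}(\mathbb T_\infty;\mathbb R^n)$; (iii) there is $L_1>0$ with $|b(k,x)-b(k,\bar x)|\le L_1|x-\bar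 x|$ and $|\sigma(k,x)-\sigma(k,\bar x)|\le L_1|x-\bar x|$ for all $k\in\mathbb T_\infty$, $x,\bar x\in\mathbb R^n$. A solution of S$\triangle$E $(b,\sigma,\eta)$ is a process $x(\cdot)\in L^{2,\rho}_{\mathbb F}(\mathbb T_\infty;\mathbb R^n)$ with $b(\cdot,x(\cdot)),\sigma(\cdot,x(\cdot))\in L^{2,\rho}_{\mathbb F}(\mathbb T_\infty;\mathbb R^n)$ satisfying the equation for every $k\in\mathbb T_\infty$ and the initial condition. *)

(* Defs.v *)
From HB Require Import structures.
From mathcomp Require Import all_boot all_order all_algebra.
From mathcomp Require Import all_classical all_reals all_analysis.

Set Implicit Arguments.
Unset Strict Implicit.
Unset Printing Implicit Defensive.

Import Order.TTheory GRing.Theory Num.Theory.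
Import numFieldNormedType.Exports.

Local Open Scope classical_set_scope.
Local Open Scope ring_scope.
Local Open Scope ereal_scope.

(* The library norm on 'rV[R]_n is the max norm; the norm |.| of R^n meant
   here is the Euclidean one. *)
Definition enorm (R : realType) (n : nat) (x : 'rV[R]_n) : R :=
  Num.sqrt (\sum_(i < n) x ord0 i ^+ 2)%R.

(* R^n with its Borel sigma-algebra. *)
Notation borel_rV R n := (g_sigma_algebraType (@open 'rV[R]_n)).

Definition measurable_wrt (d d' : measure_display) (T : measurableType d)
    (V : measurableType d') (G : set (set T)) (f : T -> V) : Prop :=
  measurable_fun [set: g_sigma_algebraType G] (f : g_sigma_algebraType G -> V).

(* Y is a version of E[X | G]. *)
Record is_cond_exp (R : realType) (d : measure_display) (T : measurableType d)
    (P : probability T R) (G : set (set T)) (X Y : T -> R) : Prop := IsCondExp {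
  cond_exp_sub : G `<=` measurable ;
  cond_exp_integrable : P.-integrable setT (EFin \o X) ;
  cond_exp_measurable : measurable_wrt G Y ;
  cond_exp_integrableY : P.-integrable setT (EFin \o Y) ;
  cond_exp_int : forall A : set T, G A ->
    \int[P]_(t in A) (X t)%:E = \int[P]_(t in A) (Y t)%:E }.

Section stochastic_difference_equation.
Context (R : realType) (d : measure_display) (T : measurableType d).
Context (P : probability T R) (n : nat).
Implicit Types (xi eta : T -> 'rV[R]_n) (w : nat -> {RV P >-> R}).
Implicit Types (F : nat -> set (set T)) (rho lip : R).
Implicit Types (g x : nat -> T -> 'rV[R]_n).
Implicit Types (b sigma : T -> nat -> 'rV[R]_n -> 'rV[R]_n).

(* Index shift: [past xi w k] is F_{k-1}, so [past xi w 0] is F_{-1} and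
   [past xi w k.+1] is the sigma-algebra F_k generated by xi, w_0, ..., w_k. *)
Definition past xi w (k : nat) : set (set T) :=
  if k is j.+1 then
    <<s preimage_set_system setT (xi : T -> borel_rV R n) measurable `|`
        \bigcup_(i in `I_j.+1) preimage_set_system setT (w i) measurable >>
  else [set set0; setT].

Definition normalized_mds F w : Prop := forall k : nat,
  is_cond_exp P (F k) (w k) (cst 0%R) /\
  is_cond_exp P (F k) (fun t => w k t ^+ 2)%R (cst 1%R).

Definition L2rho F rho g : Prop :=
  (forall k, measurable_wrt (F k) (g k : T -> borel_rV R n)) /\
  \int[P]_t (\sum_(0 <= k <oo)
    (expR (- rho * k%:R) * enorm (g k t) ^+ 2)%:E) < +oo.

Definition L2init F eta : Prop :=
  measurable_wrt (F 0%N) (eta : T -> borel_rV R n) /\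
  \int[P]_t (enorm (eta t) ^+ 2)%:E < +oo.

(* The Lipschitz bounds hold almost surely, with one null set for all k, x, y. *)
Record assumptionA F rho lip b sigma eta : Prop := AssumptionA {
  A_init : L2init F eta ;
  A_b_measurable : forall k (y : 'rV[R]_n),
    measurable_wrt (F k) (fun t => b t k y : borel_rV R n) ;
  A_sigma_measurable : forall k (y : 'rV[R]_n),
    measurable_wrt (F k) (fun t => sigma t k y : borel_rV R n) ;
  A_b0 : L2rho F rho (fun k t => b t k 0%R) ;
  A_sigma0 : L2rho F rho (fun k t => sigma t k 0%R) ;
  A_lip_gt0 : (0 < lip)%R ;
  A_b_lipschitz : {ae P, forall t, forall (k : nat) (x y : 'rV[R]_n),
    (enorm (b t k x - b t k y) <= lip * enorm (x - y))%R} ;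
  A_sigma_lipschitz : {ae P, forall t, forall (k : nat) (x y : 'rV[R]_n),
    (enorm (sigma t k x - sigma t k y) <= lip * enorm (x - y))%R} }.

Record is_solution F rho w b sigma eta x : Prop := IsSolution {
  sol_L2 : L2rho F rho x ;
  sol_b_L2 : L2rho F rho (fun k t => b t k (x k t)) ;
  sol_sigma_L2 : L2rho F rho (fun k t => sigma t k (x k t)) ;
  sol_init : {ae P, forall t, x 0%N t = eta t} ;
  sol_step : forall k, {ae P, forall t,
    x k.+1 t = (b t k (x k t) + w k t *: sigma t k (x k t))%R} }.

End stochastic_difference_equation.

(* Main.v *)
Require Import Defs.
From mathcomp Require Import all_boot all_order all_algebra.
From mathcomp Require Import all_classical all_reals all_analysis.
From mathcomp Require Import measurable_realfun ring lra.

Set Implicit Arguments.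
Unset Strict Implicit.

Import Order.TTheory GRing.Theory Num.Theory.
Import numFieldNormedType.Exports.

Import HBNNSimple.

Local Open Scope classical_set_scope.
Local Open Scope ring_scope.
Local Open Scope ereal_scope.

(** The weighted second moments of a solution obey a linear recursion.  If
    [D_(k+1) = B_k + w_k S_k] with [B_k] and [S_k] known at the time of [F_k],
    then conditioning on [F_k], with [E[w_k | F_k] = 0] and
    [E[w_k^2 | F_k] = 1], kills the cross term and gives
    [E|D_(k+1)|^2 = E|B_k|^2 + E|S_k|^2].  For [D = x] (resp. [D = x - x'])
    the Lipschitz bounds give, almost surely,
    [|B_k|^2 + |S_k|^2 <= 4 L1^2 |D_k|^2 + 2 g_k], where [g_k] is the k-th
    summand, before weighting, of the right-hand side to be reached.
    Multiplying by [e^(- rho (k + 1))], the numbers [a_k = e^(- rho k) E|D_k|^2] satisfy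
    [a_(k+1) <= q a_k + 2 e^(- rho) e^(- rho k) E[g_k]] with
    [q = 4 L1^2 e^(- rho)], and [rho > ln (4 L1^2)] says exactly that [q < 1].
    Summing the geometric recursion yields the claim with
    [C = (1 - q)^-1 (1 + 2 e^(- rho))], which depends on [L1] and [rho] only.

    The pieces are [integral_mul_agree] (conditional expectations seen as two
    densities with the same integral on every set of a sub-sigma-algebra, hence
    the same integral against every function measurable for it),
    [integral_enorm_sqrD_cond] (the orthogonality identity),
    [nneseries_gronwall] (the summed recursion) and
    [weighted_second_moment_le] (the estimate common to both inequalities).

    One point needs care.  In the second inequality
    [g_k = |b(k, x'_k) - b'(k, x'_k)|^2 + |sigma(k, x'_k) - sigma'(k, x'_k)|^2]
    involves the composition of [b] with [x'], so that its measurability would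
    call for a separate argument (of Caratheodory type, in a completed space).
    The integral of a nonnegative function is a supremum over simple functions
    below it, hence monotone for arbitrary functions, and it is enough to bound
    [g_k] from below, almost surely, by the positive part of
    [(|B_k|^2 + |S_k|^2 - 4 L1^2 |D_k|^2) / 2], which is measurable. *)

(** * The Euclidean norm *)

Lemma enorm_sqr (R : realType) (n : nat) (x : 'rV[R]_n) :
  (enorm x ^+ 2 = \sum_(i < n) x ord0 i ^+ 2)%R.
Proof. by rewrite sqr_sqrtr// sumr_ge0// => i _; exact: sqr_ge0. Qed.

Lemma enorm_sqrD_le (R : realType) (n : nat) (x y : 'rV[R]_n) :
  (enorm (x + y) ^+ 2 <= 2 * enorm x ^+ 2 + 2 * enorm y ^+ 2)%R.
Proof.
rewrite !enorm_sqr !mulr_sumr -big_split/= ler_sum// => i _.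
by rewrite mxE; have := sqr_ge0 (x ord0 i - y ord0 i); lra.
Qed.

Lemma enormB_sqr_le (R : realType) (n : nat) (x y : 'rV[R]_n) :
  (enorm (x - y) ^+ 2 <= 2 * enorm x ^+ 2 + 2 * enorm y ^+ 2)%R.
Proof.
rewrite !enorm_sqr !mulr_sumr -big_split/= ler_sum// => i _.
by rewrite !mxE; have := sqr_ge0 (x ord0 i + y ord0 i); lra.
Qed.

Lemma lipschitz_sqr_le (R : realType) (n : nat) (L : R) (u v r z : 'rV[R]_n) :
  (enorm (u - v) <= L * enorm z)%R ->
  (enorm (u - r) ^+ 2 <=
    2 * L ^+ 2 * enorm z ^+ 2 + 2 * enorm (v - r) ^+ 2)%R.
Proof.
move=> uv; have -> : (u - r = (u - v) + (v - r))%R by rewrite addrA subrK.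
apply: le_trans (enorm_sqrD_le _ _) _; rewrite lerD2r -mulrA -exprMn.
by rewrite ler_wpM2l// lerXn2r ?nnegrE ?sqrtr_ge0// (le_trans (sqrtr_ge0 _) uv).
Qed.

(** * Integrals of nonnegative functions *)

(** Enlarging an arbitrary nonnegative function enlarges the set of simple
    functions over which the supremum defining its integral is taken. *)
Lemma le_integralT (d : measure_display) (T : measurableType d) (R : realType)
    (mu : {measure set T -> \bar R}) (f g : T -> \bar R) :
  (forall t, 0 <= f t) -> (forall t, f t <= g t) ->
  \int[mu]_t f t <= \int[mu]_t g t.
Proof.
move=> f0 fg; rewrite !ge0_integralTE//; last first.
  by move=> t; exact: le_trans (fg t).
apply: le_ereal_sup => _ [h hf <-].
by exists h => // t; exact: le_trans (hf t) (fg t).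
Qed.

(** The measurable function [f] is cut off to zero on the exceptional null set,
    which preserves its integral, and lies below [g] everywhere thereafter. *)
Lemma ae_le_integralT (d : measure_display) (T : measurableType d)
    (R : realType) (mu : {measure set T -> \bar R}) (f g : T -> \bar R) :
  measurable_fun [set: T] f -> (forall t, 0 <= f t) -> (forall t, 0 <= g t) ->
  {ae mu, forall t, f t <= g t} -> \int[mu]_t f t <= \int[mu]_t g t.
Proof.
move=> mf f0 g0 [N [mN N0 fgN]].
rewrite (@ge0_negligible_integral _ _ _ mu setT N)// integral_mkcond.
apply: le_integralT => t; rewrite patchE; case: ifPn => // /set_mem[_ Nt].
by apply: contrapT => ?; exact/Nt/fgN.
Qed.

(** * Measurability with respect to a sub-sigma-algebra *)

Lemma measurable_wrt_sub (d d' : measure_display) (T : measurableType d)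
    (V : measurableType d') (G : set (set T)) (f : T -> V) :
  G `<=` measurable -> measurable_wrt G f -> measurable_fun [set: T] f.
Proof.
move=> Gm mf _ Y mY.
apply: (smallest_sub (@sigma_algebra_measurable _ T) Gm).
exact: (mf measurableT Y mY).
Qed.

Lemma measurable_wrt_coord (d : measure_display) (T : measurableType d)
    (R : realType) (n : nat) (G : set (set T)) (f : T -> 'rV[R]_n) (i : 'I_n) :
  measurable_wrt G (f : T -> borel_rV R n) ->
  measurable_wrt G (fun t => f t ord0 i).
Proof.
move=> mf.
have mi : measurable_fun [set: borel_rV R n]
    (fun v : borel_rV R n => (v : 'rV[R]_n) ord0 i).
  apply: (measurability _ (RGenOpens.measurableE R)).
  move=> _ [_ [a [b ->] <-]]; apply: sub_sigma_algebra; rewrite setTI.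
  have /continuousP := @coord_continuous R 1 n ord0 i.
  by apply; exact: interval_open.
exact: measurableT_comp mi mf.
Qed.

(** * Conditional expectation tested against measurable functions *)

(** The hypothesis is the conclusion for indicators of sets of [G]; simple
    functions follow by linearity, and nonnegative [G]-measurable functions by
    monotone convergence.  This is how the set-wise definition of conditional
    expectation is used: both [E[X Z] = E[E[X | G] Z]] for nonnegative [X] and
    the comparison of the positive and negative parts of a centred variable are
    instances. *)
Lemma integral_mul_agree (d : measure_display) (T : measurableType d)
    (R : realType) (mu : {measure set T -> \bar R}) (G : set (set T))
    (U V f : T -> R) :
  sigma_algebra setT G -> G `<=` measurable ->
  measurable_fun [set: T] U -> measurable_fun [set: T] V ->
  (forall t, 0 <= U t)%R -> (forall t, 0 <= V t)%R ->
  (forall A, G A -> \int[mu]_(t in A) (U t)%:E = \int[mu]_(t in A) (V t)%:E) ->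
  measurable_wrt G f -> (forall t, 0 <= f t)%R ->
  \int[mu]_t (f t * U t)%:E = \int[mu]_t (f t * V t)%:E.
Proof.
move=> sG Gm mU mV U0 V0 UV mf f0.
(* The approximating simple functions live on [T] equipped with [G], so that
   their level sets belong to [G]. *)
have mfE : measurable_fun [set: g_sigma_algebraType G]
    (EFin \o (f : g_sigma_algebraType G -> R)) by exact/measurable_EFinP.
pose h := nnsfun_approx measurableT mfE.
have h_ge0 n t : (0 <= (h n : T -> R) t)%R by exact: fun_ge0.
have mh n : measurable_fun [set: T] (h n : T -> R).
  apply: (@measurable_wrt_sub d _ T _ G (h n : T -> R) Gm).
  exact: (@measurable_funPT _ _ _ _ (h n)).
have limE (W : T -> R) : (forall t, 0 <= W t)%R -> measurable_fun [set: T] W ->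
    \int[mu]_t (f t * W t)%:E =
    limn (fun n => \int[mu]_t ((h n : T -> R) t * W t)%:E).
  move=> W0 mW; rewrite -monotone_convergence//.
  - apply: eq_integral => t _; apply/esym/cvg_lim => //.
    under eq_fun do rewrite EFinM; rewrite EFinM.
    apply: cvgeZr => //.
    apply: (@cvg_nnsfun_approx _ _ _ _ measurableT _ mfE) => // s _.
    by rewrite lee_fin.
  - by move=> n; apply/measurable_EFinP; exact: measurable_funM.
  - by move=> n t _; rewrite lee_fin mulr_ge0.
  - move=> t _ a b ab; rewrite lee_fin ler_wpM2r//.
    by have /lefP := nd_nnsfun_approx measurableT mfE ab; exact.
(* By [limE] it suffices to compare simple functions, and these integrate to
   combinations of integrals over sets of [G]. *)
suff simpleE (W : T -> R) : (forall t, 0 <= W t)%R ->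
    measurable_fun [set: T] W -> forall n,
    \int[mu]_t ((h n : T -> R) t * W t)%:E =
    \sum_(y \in range (h n)) y%:E * \int[mu]_(t in h n @^-1` [set y]) (W t)%:E.
  rewrite !limE//; congr (limn _); apply/funext => n.
  rewrite !simpleE//; apply: eq_fsbigr => y _; congr (_ * _); apply: UV.
  have : <<s G >> (h n @^-1` [set y]).
    exact: (measurable_funPTI (h n) (measurable_set1 y)).
  by rewrite (sigma_algebra_id sG).
move=> W0 mW n.
have mWE : measurable_fun [set: T] (EFin \o W) by exact/measurable_EFinP.
have mpre y : measurable (h n @^-1` [set y] : set T).
  by rewrite -[X in measurable X]setTI; exact: (mh n measurableT).
transitivity (\int[mu]_t (\sum_(y \in range (h n))
    (y * \1_(h n @^-1` [set y] : set T) t * W t)%:E)).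
  apply: eq_integral => t _.
  by rewrite {1}(fimfunE (h n) t) mulr_fsuml fsumEFin.
rewrite ge0_integral_fsum//; last 2 first.
- move=> y; apply/measurable_EFinP; apply: measurable_funM => //.
  exact: measurable_funM.
- move=> y t _; rewrite EFinM mule_ge0 ?lee_fin//.
  by have := nnfun_muleindic_ge0 (h n) y t; rewrite lee_fin.
apply: eq_fsbigr => y /set_mem[s _ <-].
rewrite [in RHS]integral_mkcond -ge0_integralZl//; last 3 first.
- apply/(measurable_restrictT _ (mpre _)); exact: measurable_funTS.
- by move=> t _; apply: erestrict_ge0 => u _; rewrite lee_fin.
- by rewrite lee_fin.
apply: eq_integral => t _; rewrite patchE indicE.
by case: ifPn; rewrite ?mulr1 ?mulr0 ?mul0r ?mule0.
Qed.

Lemma integral_max0B (d : measure_display) (T : measurableType d)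
    (R : realType) (mu : {measure set T -> \bar R}) (A : set T) (f : T -> R) :
  \int[mu]_(t in A) (f t)%:E =
  \int[mu]_(t in A) (Num.max (f t) 0)%:E -
  \int[mu]_(t in A) (Num.max (- f t) 0)%:E.
Proof.
by rewrite integralE; congr (_ - _); apply: eq_integral => t _;
  rewrite ?funeposE ?funenegE -?EFinN -EFin_max.
Qed.

Lemma integral_max0_fin_num (d : measure_display) (T : measurableType d)
    (R : realType) (mu : {measure set T -> \bar R}) (A : set T) (f : T -> R) :
  measurable A -> mu.-integrable A (EFin \o f) ->
  \int[mu]_(t in A) (Num.max (f t) 0)%:E \is a fin_num /\
  \int[mu]_(t in A) (Num.max (- f t) 0)%:E \is a fin_num.
Proof.
move=> mA fi; split.
  under eq_integral do rewrite EFin_max -(funeposE (EFin \o f)).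
  exact: integrable_pos_fin_num.
under eq_integral do rewrite EFin_max EFinN -(funenegE (EFin \o f)).
exact: integrable_neg_fin_num.
Qed.

(** [E[X | G] = 0] means that the positive and negative parts of [X] have equal
    integrals on every set of [G].  They are therefore exchangeable against
    [G]-measurable weights, and exchanging them in
    [(XY)^+ = X^+ Y^+ + X^- Y^-] produces [(XY)^- = X^- Y^+ + X^+ Y^-]. *)
Lemma integral_mul_cond_exp0 (d : measure_display) (T : measurableType d)
    (R : realType) (P : probability T R) (G : set (set T)) (X Y : T -> R) :
  sigma_algebra setT G -> is_cond_exp P G X (cst 0%R) ->
  measurable_wrt G Y -> P.-integrable setT (EFin \o (fun t => X t * Y t)%R) ->
  \int[P]_t (X t * Y t)%:E = 0.
Proof.
move=> sG [Gm iX _ _ X0] mY iXY.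
have mX : measurable_fun [set: T] X.
  exact/measurable_EFinP/(measurable_int _ iX).
have mYT := measurable_wrt_sub Gm mY.
pose p (Z : T -> R) t := Num.max (Z t) 0%R.
pose m (Z : T -> R) t := Num.max (- Z t)%R 0%R.
have p0 Z t : (0 <= p Z t)%R by rewrite le_max lexx orbT.
have m0 Z t : (0 <= m Z t)%R by rewrite le_max lexx orbT.
have mp d' (T' : measurableType d') (Z : T' -> R) :
    measurable_fun [set: T'] Z ->
    measurable_fun [set: T'] (fun t => Num.max (Z t) 0%R).
  by move=> mZ; exact: measurable_maxr.
have mm d' (T' : measurableType d') (Z : T' -> R) :
    measurable_fun [set: T'] Z ->
    measurable_fun [set: T'] (fun t => Num.max (- Z t)%R 0%R).
  by move=> mZ; apply: measurable_maxr => //; exact: measurable_funN.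
have XpE A : G A -> \int[P]_(t in A) (p X t)%:E = \int[P]_(t in A) (m X t)%:E.
  move=> GA; have mA := Gm _ GA.
  have iXA : P.-integrable A (EFin \o X) by exact: integrableS iX.
  have [fp fm] := integral_max0_fin_num mA iXA.
  have := X0 A GA; rewrite integral_max0B integral0.
  move: fp fm => /fineK <- /fineK <-; rewrite -EFinB => -[/eqP].
  by rewrite subr_eq0 => /eqP ->.
have swap (Z : T -> R) : measurable_wrt G Z -> (forall t, 0 <= Z t)%R ->
    \int[P]_t (Z t * p X t)%:E = \int[P]_t (Z t * m X t)%:E.
  move=> mZ Z0; apply: (integral_mul_agree sG Gm _ _ _ _ XpE) => //.
    exact: mp.
  exact: mm.
have [fp fm] := integral_max0_fin_num measurableT iXY.
rewrite integral_max0B.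
suff <- : \int[P]_t (Num.max (X t * Y t) 0)%:E =
    \int[P]_t (Num.max (- (X t * Y t)) 0)%:E by rewrite subee.
transitivity (\int[P]_t ((p Y t * p X t)%:E + (m Y t * m X t)%:E)).
  apply: eq_integral => t _; rewrite -EFinD /p /m; congr EFin.
  by rewrite !maxr_absE !subr0 !normrN normrM; field.
transitivity (\int[P]_t ((p Y t * m X t)%:E + (m Y t * p X t)%:E)); last first.
  apply: eq_integral => t _; rewrite -EFinD /p /m; congr EFin.
  by rewrite !maxr_absE !subr0 !normrN normrM; field.
have mE (Z W : T -> R) :
    measurable_fun [set: T] Z -> measurable_fun [set: T] W ->
    measurable_fun [set: T] (fun t => (Z t * W t)%:E).
  by move=> mZ mW; apply/measurable_EFinP; exact: measurable_funM.
rewrite !ge0_integralD//; try (by move=> t _; rewrite lee_fin mulr_ge0);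
  try (by apply: mE; by [exact: mp | exact: mm]).
by rewrite !swap// => [|]; [exact: mm|exact: mp].
Qed.

(** * Orthogonality of the noise increments *)

(** [E[w b s] = 0] because [b s] is known given [G], and [E[w^2 s^2] = E[s^2]]
    because [w^2] averages to 1 given [G]. *)
Lemma integral_sqrD_cond (d : measure_display) (T : measurableType d)
    (R : realType) (P : probability T R) (G : set (set T)) (w b s : T -> R) :
  sigma_algebra setT G -> is_cond_exp P G w (cst 0%R) ->
  is_cond_exp P G (fun t => w t ^+ 2)%R (cst 1%R) ->
  measurable_wrt G b -> measurable_wrt G s ->
  \int[P]_t (b t ^+ 2)%:E < +oo -> \int[P]_t (s t ^+ 2)%:E < +oo ->
  \int[P]_t ((b t + w t * s t) ^+ 2)%:E =
  \int[P]_t (b t ^+ 2)%:E + \int[P]_t (s t ^+ 2)%:E.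
Proof.
move=> sG cw cw2 mb ms b2 s2.
have [Gm iw _ _ _] := cw.
have mw : measurable_fun [set: T] w.
  exact/measurable_EFinP/(measurable_int _ iw).
have mbT := measurable_wrt_sub Gm mb; have msT := measurable_wrt_sub Gm ms.
have ws2 : \int[P]_t (s t ^+ 2 * w t ^+ 2)%:E = \int[P]_t (s t ^+ 2)%:E.
  transitivity (\int[P]_t (s t ^+ 2 * (cst 1%R : T -> R) t)%:E); last first.
    by apply: eq_integral => t _; rewrite mulr1.
  apply: (integral_mul_agree sG Gm) => //.
  - exact: measurable_funX.
  - by move=> t; exact: sqr_ge0.
  - exact: (cond_exp_int cw2).
  - exact: measurable_funX.
  - by move=> t; exact: sqr_ge0.
have sq_int (f : T -> R) : measurable_fun [set: T] f ->
    (forall t, 0 <= f t)%R -> \int[P]_t (f t)%:E < +oo ->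
    P.-integrable [set: T] (EFin \o f).
  move=> mf f0 fi; apply/integrableP; split; first exact/measurable_EFinP.
  by under eq_integral do rewrite /= ger0_norm//.
have ib : P.-integrable [set: T] (EFin \o (fun t => b t ^+ 2)%R).
  by apply: sq_int => //; [exact: measurable_funX|move=> t; exact: sqr_ge0].
have iws : P.-integrable [set: T] (EFin \o (fun t => s t ^+ 2 * w t ^+ 2)%R).
  apply: sq_int; last by rewrite ws2.
    by apply: measurable_funM; exact: measurable_funX.
  by move=> t; rewrite mulr_ge0 ?sqr_ge0.
(* The cross term is dominated by [b^2 + w^2 s^2], whose second summand is
   integrable because conditioning replaces [w^2] by 1. *)
have ic : P.-integrable [set: T] (EFin \o (fun t => w t * (b t * s t))%R).
  apply: (le_integrable measurableT _ _ (integrableD measurableT ib iws)).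
    apply/measurable_EFinP/measurable_funM => //; exact: measurable_funM.
  move=> t _ /=; rewrite lee_fin [leRHS]ger0_norm; last first.
    by apply: addr_ge0; [exact: sqr_ge0|apply: mulr_ge0; exact: sqr_ge0].
  rewrite ler_norml; have := sqr_ge0 (b t + w t * s t).
  have := sqr_ge0 (b t - w t * s t); have := sqr_ge0 (b t).
  have := sqr_ge0 (w t * s t).
  by move=> ? ? ? ?; apply/andP; split; nra.
have c0 := integral_mul_cond_exp0 sG cw (measurable_funM mb ms) ic.
transitivity (\int[P]_t (((b t ^+ 2)%:E + (s t ^+ 2 * w t ^+ 2)%:E) +
    2%:E * (w t * (b t * s t))%:E)).
  by apply: eq_integral => t _; rewrite -EFinM -!EFinD; congr EFin; ring.
rewrite integralD//=; last 2 first.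
- exact: integrableD.
- exact: integrableZl.
by rewrite integralD// integralZl// c0 mule0 adde0 ws2.
Qed.

Lemma integral_enorm_sqr (d : measure_display) (T : measurableType d)
    (R : realType) (mu : {measure set T -> \bar R}) (n : nat)
    (f : T -> 'rV[R]_n) :
  (forall i, measurable_fun [set: T] (fun t => f t ord0 i)) ->
  \int[mu]_t (enorm (f t) ^+ 2)%:E =
  \sum_(i < n) \int[mu]_t (f t ord0 i ^+ 2)%:E.
Proof.
move=> mf; rewrite -ge0_integral_sum//.
- by apply: eq_integral => t _; rewrite enorm_sqr sumEFin.
- by move=> i; apply/measurable_EFinP; exact: measurable_funX.
- by move=> i t _; rewrite lee_fin sqr_ge0.
Qed.

Lemma measurable_enorm_sqr (d : measure_display) (T : measurableType d)
    (R : realType) (n : nat) (f : T -> 'rV[R]_n) :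
  (forall i, measurable_fun [set: T] (fun t => f t ord0 i)) ->
  measurable_fun [set: T] (fun t => enorm (f t) ^+ 2)%R.
Proof.
move=> mf; under eq_fun do rewrite enorm_sqr.
by apply: measurable_sum => i; exact: measurable_funX.
Qed.

Lemma integral_enorm_sqrD_cond (d : measure_display) (T : measurableType d)
    (R : realType) (P : probability T R) (G : set (set T)) (n : nat)
    (w : T -> R) (b s : T -> 'rV[R]_n) :
  sigma_algebra setT G -> is_cond_exp P G w (cst 0%R) ->
  is_cond_exp P G (fun t => w t ^+ 2)%R (cst 1%R) ->
  (forall i, measurable_wrt G (fun t => b t ord0 i)) ->
  (forall i, measurable_wrt G (fun t => s t ord0 i)) ->
  \int[P]_t (enorm (b t) ^+ 2)%:E < +oo ->
  \int[P]_t (enorm (s t) ^+ 2)%:E < +oo ->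
  \int[P]_t (enorm (b t + w t *: s t) ^+ 2)%:E =
  \int[P]_t (enorm (b t) ^+ 2)%:E + \int[P]_t (enorm (s t) ^+ 2)%:E.
Proof.
move=> sG cw cw2 mb ms b2 s2; have [Gm iw _ _ _] := cw.
have mw : measurable_fun [set: T] w.
  exact/measurable_EFinP/(measurable_int _ iw).
have mbT i := measurable_wrt_sub Gm (mb i).
have msT i := measurable_wrt_sub Gm (ms i).
have coord_fin (f : T -> 'rV[R]_n) i : \int[P]_t (enorm (f t) ^+ 2)%:E < +oo ->
    \int[P]_t (f t ord0 i ^+ 2)%:E < +oo.
  apply: le_lt_trans; apply: le_integralT => t; rewrite lee_fin ?sqr_ge0//.
  rewrite enorm_sqr (bigD1 i)//= lerDl sumr_ge0// => j _; exact: sqr_ge0.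
rewrite !integral_enorm_sqr//; last first.
  move=> i; under eq_fun do rewrite !mxE.
  by apply: measurable_funD => //; exact: measurable_funM.
rewrite -big_split/=; apply: eq_bigr => i _.
rewrite -(integral_sqrD_cond sG cw cw2 (mb i) (ms i)) ?coord_fin//.
by apply: eq_integral => t _; rewrite !mxE.
Qed.

(** * The recursion on weighted second moments *)

(** By induction every partial sum stays below [M / (1 - q)], where
    [M = a_0 + c sum u]: a partial sum with one more term is at most
    [M + q (M / (1 - q)) = M / (1 - q)]. *)
Lemma nneseries_gronwall (R : realType) (q c : R) (a u : nat -> \bar R) :
  (0 <= q)%R -> (q < 1)%R -> (0 <= c)%R ->
  (forall k, 0 <= a k) -> (forall k, 0 <= u k) ->
  (forall k, a k.+1 <= q%:E * a k + c%:E * u k) ->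
  \sum_(0 <= k <oo) a k <=
  ((1 - q)^-1)%:E * (a 0%N + c%:E * \sum_(0 <= k <oo) u k).
Proof.
move=> q0 q1 c0 a0 u0 aS; set M := _ + _.
have U0 : 0 <= \sum_(0 <= k <oo) u k by exact: nneseries_ge0.
have M0 : 0 <= M by rewrite adde_ge0// mule_ge0// lee_fin.
have r0 : (0 <= (1 - q)^-1)%R by rewrite invr_ge0 subr_ge0 ltW.
have step : M + q%:E * (((1 - q)^-1)%:E * M) = ((1 - q)^-1)%:E * M.
  rewrite muleA -EFinM -{1}(mul1e M) -ge0_muleDl ?lee_fin ?mulr_ge0//.
  by rewrite -EFinD; congr (_%:E * _); field; rewrite subr_eq0 gt_eqF.
apply: lime_le; first exact: is_cvg_nneseries.
apply: nearW => N; elim: N => [|N IH].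
  by rewrite big_geq// mule_ge0// lee_fin.
rewrite big_nat_recl//= -step.
apply: (@le_trans _ _ (a 0%N + \sum_(0 <= i < N) (q%:E * a i + c%:E * u i))).
  by apply: leeD2l; exact: lee_sum.
rewrite big_split/= -!ge0_sume_distrr//.
rewrite [X in _ + X]addeC addeA leeD//.
  rewrite leeD2l// lee_wpmul2l ?lee_fin//.
  exact: nneseries_lim_ge.
by rewrite lee_wpmul2l ?lee_fin.
Qed.

(** The estimate behind both inequalities, for any pair of drift and noise
    coefficients dominated as in the last hypothesis.  The source term [g] is
    an arbitrary nonnegative process, so as to cover the discrepancy of two
    coefficients evaluated along a random trajectory. *)
Lemma weighted_second_moment_le (d : measure_display) (T : measurableType d)
    (R : realType) (P : probability T R) (n : nat) (F : nat -> set (set T))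
    (w : nat -> {RV P >-> R}) (rho L : R) (eta : T -> 'rV[R]_n)
    (D B S : nat -> T -> 'rV[R]_n) (g : nat -> T -> R) :
  (0 <= L)%R -> (4 * L ^+ 2 * expR (- rho) < 1)%R ->
  (forall k, sigma_algebra setT (F k)) -> normalized_mds F w ->
  (forall k i, measurable_wrt (F k) (fun t => D k t ord0 i)) ->
  (forall k i, measurable_wrt (F k) (fun t => B k t ord0 i)) ->
  (forall k i, measurable_wrt (F k) (fun t => S k t ord0 i)) ->
  (forall k, \int[P]_t (enorm (B k t) ^+ 2)%:E < +oo) ->
  (forall k, \int[P]_t (enorm (S k t) ^+ 2)%:E < +oo) ->
  {ae P, forall t, D 0%N t = eta t} ->
  (forall k, {ae P, forall t, D k.+1 t = B k t + w k t *: S k t}%R) ->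
  (forall k t, 0 <= g k t)%R ->
  {ae P, forall t, forall k, (enorm (B k t) ^+ 2 + enorm (S k t) ^+ 2 <=
    4 * L ^+ 2 * enorm (D k t) ^+ 2 + 2 * g k t)%R} ->
  \sum_(0 <= k <oo) (expR (- rho * k%:R))%:E *
      'E_P[fun t => (enorm (D k t) ^+ 2)%R] <=
  ((1 - 4 * L ^+ 2 * expR (- rho))^-1 * (1 + 2 * expR (- rho)))%:E *
  \int[P]_t ((enorm (eta t) ^+ 2)%:E +
    \sum_(0 <= k <oo) (expR (- rho * k%:R) * g k t)%:E).
Proof.
move=> L0 q1 sF mds mD mB mS B2 S2 D0 DS g0 BSg.
set q := (4 * L ^+ 2 * expR (- rho))%R in q1 *.
have q0 : (0 <= q)%R by rewrite !mulr_ge0 ?expR_ge0 ?sqr_ge0.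
have l0 : (0 <= 4 * L ^+ 2)%R by apply: mulr_ge0; rewrite ?sqr_ge0.
have Fm k : F k `<=` measurable by have [[]] := mds k.
have mDT k i := measurable_wrt_sub (@Fm k) (mD k i).
have mBT k i := measurable_wrt_sub (@Fm k) (mB k i).
have mST k i := measurable_wrt_sub (@Fm k) (mS k i).
have mw k : measurable_fun [set: T] (w k) by exact: measurable_funPT.
(* The least nonnegative [m] with
   [|B|^2 + |S|^2 <= 4 L^2 |D|^2 + 2 m]: an almost sure measurable minorant of
   [g]. *)
pose m k t := Num.max 0%R ((enorm (B k t) ^+ 2 + enorm (S k t) ^+ 2 -
  4 * L ^+ 2 * enorm (D k t) ^+ 2) / 2)%R.
have m0 k t : (0 <= m k t)%R by rewrite le_max lexx.
have mm k : measurable_fun [set: T] (m k).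
  apply: measurable_maxr => //; apply: measurable_funM => //.
  apply: measurable_funB.
    by apply: measurable_funD; exact: measurable_enorm_sqr.
  by apply: measurable_funM => //; exact: measurable_enorm_sqr.
have e0 k : (0 <= expR (- rho * k%:R))%R by exact: expR_ge0.
pose a k := (expR (- rho * k%:R))%:E * \int[P]_t (enorm (D k t) ^+ 2)%:E.
pose u k := (expR (- rho * k%:R))%:E * \int[P]_t (m k t)%:E.
have a0 k : 0 <= a k.
  by rewrite mule_ge0 ?lee_fin// integral_ge0// => t _; rewrite lee_fin sqr_ge0.
have u0 k : 0 <= u k.
  by rewrite mule_ge0 ?lee_fin// integral_ge0// => t _; rewrite lee_fin.
have mDE k : measurable_fun [set: T] (fun t => (enorm (D k t) ^+ 2)%:E).
  by apply/measurable_EFinP; exact: measurable_enorm_sqr.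
have mmE k : measurable_fun [set: T] (fun t => (m k t)%:E).
  by apply/measurable_EFinP.
have aS k : a k.+1 <= q%:E * a k + (2 * expR (- rho))%:E * u k.
  rewrite /a /u.
  have -> : \int[P]_t (enorm (D k.+1 t) ^+ 2)%:E =
      \int[P]_t (enorm (B k t) ^+ 2)%:E + \int[P]_t (enorm (S k t) ^+ 2)%:E.
    have [cw cw2] := mds k.
    rewrite -(integral_enorm_sqrD_cond (sF k) cw cw2)//.
    apply: ge0_ae_eq_integral => //.
    - apply/measurable_EFinP; apply: measurable_enorm_sqr => i.
      under eq_fun do rewrite !mxE.
      by apply: measurable_funD => //; exact: measurable_funM.
    - by move=> t _; rewrite lee_fin sqr_ge0.
    - by move=> t _; rewrite lee_fin sqr_ge0.
    - by apply: filterS (DS k) => t -> _.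
  have -> : expR (- rho * k.+1%:R) = (expR (- rho) * expR (- rho * k%:R))%R.
    by rewrite -expRD; congr expR; rewrite -natr1; ring.
  have -> :
      q%:E * ((expR (- rho * k%:R))%:E * \int[P]_t (enorm (D k t) ^+ 2)%:E) +
      (2 * expR (- rho))%:E *
        ((expR (- rho * k%:R))%:E * \int[P]_t (m k t)%:E) =
      (expR (- rho) * expR (- rho * k%:R))%:E *
      \int[P]_t ((4 * L ^+ 2 * enorm (D k t) ^+ 2)%:E + (2 * m k t)%:E).
    rewrite ge0_integralD//; last 4 first.
    - by move=> t _; rewrite lee_fin; apply: mulr_ge0; rewrite ?l0 ?sqr_ge0.
    - apply/measurable_EFinP/measurable_funM => //; exact: measurable_enorm_sqr.
    - by move=> t _; rewrite lee_fin mulr_ge0.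
    - by apply/measurable_EFinP/measurable_funM.
    under eq_integral do rewrite EFinM.
    rewrite ge0_integralZl//; last by move=> t _; rewrite lee_fin sqr_ge0.
    under [X in _ = _ * (_ + X)]eq_integral do rewrite EFinM.
    rewrite [X in _ = _ * (_ + X)]ge0_integralZl//; last first.
      by move=> t _; rewrite lee_fin.
    have i1 : 0 <= (4 * L ^+ 2)%:E * \int[P]_t (enorm (D k t) ^+ 2)%:E.
      apply: mule_ge0; first by rewrite lee_fin.
      by apply: integral_ge0 => t _; rewrite lee_fin sqr_ge0.
    have i2 : 0 <= 2%:E * \int[P]_t (m k t)%:E.
      by apply: mule_ge0 => //; apply: integral_ge0 => t _; rewrite lee_fin.
    rewrite (ge0_muleDr _ i1 i2).
    by rewrite !muleA -!EFinM; congr (_%:E * _ + _%:E * _); rewrite /q; ring.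
  rewrite lee_wpmul2l ?lee_fin ?mulr_ge0 ?expR_ge0//.
  rewrite -ge0_integralD//; last 4 first.
  - by move=> t _; rewrite lee_fin sqr_ge0.
  - by apply/measurable_EFinP; exact: measurable_enorm_sqr.
  - by move=> t _; rewrite lee_fin sqr_ge0.
  - by apply/measurable_EFinP; exact: measurable_enorm_sqr.
  apply: le_integralT => t.
    by rewrite -EFinD lee_fin addr_ge0 ?sqr_ge0.
  rewrite -!EFinD lee_fin -lerBlDl [(2 * _)%R]mulrC -ler_pdivrMr//.
  by rewrite /m le_max lexx orbT.
have -> : \sum_(0 <= k <oo) (expR (- rho * k%:R))%:E *
    'E_P[fun t => (enorm (D k t) ^+ 2)%R] = \sum_(0 <= k <oo) a k.
  by apply: eq_eseriesr => k _; rewrite unlock.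
have c0 : (0 <= 2 * expR (- rho))%R by rewrite mulr_ge0 ?expR_ge0.
have r0 : (0 <= (1 - q)^-1)%R by rewrite invr_ge0 subr_ge0 ltW.
apply: (le_trans (nneseries_gronwall q0 q1 c0 a0 u0 aS)).
rewrite [in leRHS]EFinM -muleA lee_wpmul2l ?lee_fin//.
have U0 : 0 <= \sum_(0 <= k <oo) u k by exact: nneseries_ge0.
apply: (@le_trans _ _
    ((1 + 2 * expR (- rho))%:E * (a 0%N + \sum_(0 <= k <oo) u k))).
  rewrite EFinD ge0_muleDr// leeD//.
    by rewrite -[leLHS]mul1e lee_wpmul2r// -EFinD lee_fin lerDl.
  by rewrite lee_wpmul2r// -EFinD lee_fin lerDr.
rewrite lee_wpmul2l ?lee_fin ?addr_ge0//.
have mu_ k :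
    measurable_fun [set: T] (fun t => (expR (- rho * k%:R) * m k t)%:E).
  by apply/measurable_EFinP/measurable_funM.
have -> : a 0%N + \sum_(0 <= k <oo) u k = \int[P]_t ((enorm (D 0%N t) ^+ 2)%:E +
    \sum_(0 <= k <oo) (expR (- rho * k%:R) * m k t)%:E).
  rewrite ge0_integralD//.
  - rewrite /a mulr0 expR0 mul1e integral_nneseries//.
      congr (_ + _); apply: eq_eseriesr => k _; rewrite /u -ge0_integralZl//.
        by move=> t _; rewrite lee_fin.
    by move=> k t _; rewrite lee_fin mulr_ge0.
  - by move=> t _; rewrite lee_fin sqr_ge0.
  - by move=> t _; apply: nneseries_ge0 => k _ _; rewrite lee_fin mulr_ge0.
  - by apply: ge0_emeasurable_sum => // k t _ _; rewrite lee_fin mulr_ge0.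
apply: ae_le_integralT.
- apply: emeasurable_funD => //.
  by apply: ge0_emeasurable_sum => // k t _ _; rewrite lee_fin mulr_ge0.
- move=> t; apply: adde_ge0; first by rewrite lee_fin sqr_ge0.
  by apply: nneseries_ge0 => k _ _; rewrite lee_fin mulr_ge0.
- move=> t; apply: adde_ge0; first by rewrite lee_fin sqr_ge0.
  by apply: nneseries_ge0 => k _ _; rewrite lee_fin mulr_ge0.
apply: filterS2 D0 BSg => t -> BSg; apply: leeD2l; apply: lee_nneseries => k _.
  by move=> _; rewrite lee_fin mulr_ge0.
rewrite lee_fin ler_wpM2l// ge_max g0/= ler_pdivrMr//.
by rewrite lerBlDl [(g k t * 2)%R]mulrC BSg.
Qed.

(** * Stochastic difference equations *)

Lemma sigma_algebra_past (R : realType) (d : measure_display)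
    (T : measurableType d) (P : probability T R) (n : nat) (xi : T -> 'rV[R]_n)
    (w : nat -> {RV P >-> R}) (k : nat) : sigma_algebra setT (past xi w k).
Proof.
case: k => [|k] /=; last exact: smallest_sigma_algebra.
split.
- by left.
- by move=> A [->|->]; [right; rewrite setD0|left; rewrite setDv].
- move=> A FA; have [[i iT]|AT] := pselect (exists i, A i = setT).
    by right; apply/seteqP; split => // t _; exists i => //; rewrite iT.
  left; apply: bigcup0 => i _.
  by case: (FA i) => // iT; exfalso; apply: AT; exists i.
Qed.

Lemma L2rho_second_moment_lty (R : realType) (d : measure_display)
    (T : measurableType d) (P : probability T R) (n : nat)
    (F : nat -> set (set T)) (rho : R) (g : nat -> T -> 'rV[R]_n) (k : nat) :
  F k `<=` measurable -> L2rho P F rho g ->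
  \int[P]_t (enorm (g k t) ^+ 2)%:E < +oo.
Proof.
move=> Fm [mg gfin].
have mk : measurable_fun [set: T]
    (fun t => (expR (- rho * k%:R) * enorm (g k t) ^+ 2)%:E).
  apply/measurable_EFinP/measurable_funM => //.
  apply: measurable_enorm_sqr => i.
  exact: measurable_wrt_sub Fm (measurable_wrt_coord i (mg k)).
have pos j t : (0 <= expR (- rho * j%:R) * enorm (g j t) ^+ 2)%R.
  by rewrite mulr_ge0 ?expR_ge0 ?sqr_ge0.
have -> : \int[P]_t (enorm (g k t) ^+ 2)%:E = (expR (rho * k%:R))%:E *
    \int[P]_t (expR (- rho * k%:R) * enorm (g k t) ^+ 2)%:E.
  rewrite -ge0_integralZl//; last by move=> t _; rewrite lee_fin.
  apply: eq_integral => t _; rewrite -EFinM mulrA -expRD mulNr.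
  by rewrite subrr expR0 mul1r.
apply: lte_mul_pinfty; rewrite ?lee_fin ?expR_ge0//.
apply: le_lt_trans gfin; apply: le_integralT => t; first by rewrite lee_fin.
have := @nneseries_lim_ge R
  (fun j => (expR (- rho * j%:R) * enorm (g j t) ^+ 2)%:E) xpredT 0 k.+1.
rewrite big_nat_recr//= => h.
apply: le_trans (h _); last by move=> j _ _; rewrite lee_fin.
by rewrite leeDr// sume_ge0// => j _; rewrite lee_fin.
Qed.

Lemma enormB_second_moment_lty (d : measure_display) (T : measurableType d)
    (R : realType) (mu : {measure set T -> \bar R}) (n : nat)
    (f g : T -> 'rV[R]_n) :
  (forall i, measurable_fun [set: T] (fun t => f t ord0 i)) ->
  (forall i, measurable_fun [set: T] (fun t => g t ord0 i)) ->
  \int[mu]_t (enorm (f t) ^+ 2)%:E < +oo ->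
  \int[mu]_t (enorm (g t) ^+ 2)%:E < +oo ->
  \int[mu]_t (enorm (f t - g t) ^+ 2)%:E < +oo.
Proof.
move=> mf mg ff gf.
have m2 (h : T -> 'rV[R]_n) :
    (forall i, measurable_fun [set: T] (fun t => h t ord0 i)) ->
    measurable_fun [set: T] (fun t => (enorm (h t) ^+ 2)%:E).
  by move=> mh; apply/measurable_EFinP; exact: measurable_enorm_sqr.
have pos (h : T -> 'rV[R]_n) t : [set: T] t -> 0 <= (enorm (h t) ^+ 2)%:E.
  by rewrite lee_fin sqr_ge0.
apply: (@le_lt_trans _ _
    (\int[mu]_t (2%:E * (enorm (f t) ^+ 2)%:E + 2%:E * (enorm (g t) ^+ 2)%:E))).
  apply: le_integralT => t; first by rewrite lee_fin sqr_ge0.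
  by rewrite -!EFinM -EFinD lee_fin enormB_sqr_le.
rewrite ge0_integralD//; first last.
- exact/measurable_funeM/m2.
- by move=> t tT; rewrite mule_ge0 ?pos.
- exact/measurable_funeM/m2.
- by move=> t tT; rewrite mule_ge0 ?pos.
have scale (h : T -> 'rV[R]_n) :
    (forall i, measurable_fun [set: T] (fun t => h t ord0 i)) ->
    \int[mu]_t (enorm (h t) ^+ 2)%:E < +oo ->
    \int[mu]_t (2%:E * (enorm (h t) ^+ 2)%:E) < +oo.
  move=> mh hf; rewrite ge0_integralZl//; [|exact: m2|exact: pos].
  exact: lte_mul_pinfty.
exact: lte_add_pinfty (scale _ mf ff) (scale _ mg gf).
Qed.

Theorem lemma2p1 (R : realType) (rho L1 : R) (L1_gt0 : (0 < L1)%R)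
    (rho_gt : (ln (4 * L1 ^+ 2) < rho)%R) :
  exists C : R, (0 < C)%R /\
  forall (d : measure_display) (T : measurableType d) (P : probability T R)
    (n : nat) (w : nat -> {RV P >-> R})
    (b sigma : T -> nat -> 'rV[R]_n -> 'rV[R]_n) (eta : T -> 'rV[R]_n)
    (x : nat -> T -> 'rV[R]_n),
  let F := past eta w in
  measure_is_complete P ->
  normalized_mds F w ->
  assumptionA P F rho L1 b sigma eta ->
  is_solution F rho w b sigma eta x ->
  \sum_(0 <= k <oo) (expR (- rho * k%:R))%:E *
      'E_P[fun t => (enorm (x k t) ^+ 2)%R]
    <= C%:E * \int[P]_t ((enorm (eta t) ^+ 2)%:E +
         \sum_(0 <= k <oo) (expR (- rho * k%:R) *
           (enorm (b t k 0%R) ^+ 2 + enorm (sigma t k 0%R) ^+ 2))%:E)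
  /\
  forall (b' sigma' : T -> nat -> 'rV[R]_n -> 'rV[R]_n) (eta' : T -> 'rV[R]_n)
    (x' : nat -> T -> 'rV[R]_n),
  assumptionA P F rho L1 b' sigma' eta' ->
  is_solution F rho w b' sigma' eta' x' ->
  \sum_(0 <= k <oo) (expR (- rho * k%:R))%:E *
      'E_P[fun t => (enorm (x k t - x' k t) ^+ 2)%R]
    <= C%:E * \int[P]_t ((enorm (eta t - eta' t) ^+ 2)%:E +
         \sum_(0 <= k <oo) (expR (- rho * k%:R) *
           (enorm (b t k (x' k t) - b' t k (x' k t)) ^+ 2 +
            enorm (sigma t k (x' k t) - sigma' t k (x' k t)) ^+ 2))%:E).
Proof.
set q := (4 * L1 ^+ 2 * expR (- rho))%R.
have q1 : (q < 1)%R.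
  rewrite /q expRN ltr_pdivrMr ?expR_gt0// mul1r -ltr_ln ?posrE ?expR_gt0//.
    by rewrite expRK.
  by rewrite mulr_gt0// exprn_gt0.
exists ((1 - q)^-1 * (1 + 2 * expR (- rho)))%R; split.
  by rewrite mulr_gt0 ?invr_gt0 ?subr_gt0// addr_gt0// mulr_gt0 ?expR_gt0.
move=> d T P n w b sigma eta x F _ mds Ab [xL2 bL2 sL2 x0 xS].
have sF k : sigma_algebra setT (F k) by exact: sigma_algebra_past.
have Fm k : F k `<=` measurable by have [[]] := mds k.
have coordT (f : nat -> T -> 'rV[R]_n) k i : L2rho P F rho f ->
    measurable_wrt (F k) (fun t => f k t ord0 i).
  by move=> [mf _]; exact: measurable_wrt_coord.
split.
  (* [D = x], and the source is the size of the coefficients at the origin. *)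
  apply: (@weighted_second_moment_le _ _ _ _ _ F w rho L1 eta x
    (fun k t => b t k (x k t)) (fun k t => sigma t k (x k t))
    (fun k t => enorm (b t k 0%R) ^+ 2 + enorm (sigma t k 0%R) ^+ 2)%R) => //.
  - exact: ltW.
  - by move=> k i; exact: (coordT x).
  - by move=> k i; exact: (coordT (fun k t => b t k (x k t))).
  - by move=> k i; exact: (coordT (fun k t => sigma t k (x k t))).
  - by move=> k; exact: (L2rho_second_moment_lty (Fm k) bL2).
  - by move=> k; exact: (L2rho_second_moment_lty (Fm k) sL2).
  - by move=> k t; rewrite addr_ge0 ?sqr_ge0.
  apply: filterS2 (A_b_lipschitz Ab) (A_sigma_lipschitz Ab) => t lb ls k.
  have := lipschitz_sqr_le 0%R (lb k (x k t) 0%R).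
  have := lipschitz_sqr_le 0%R (ls k (x k t) 0%R).
  by rewrite !subr0; lra.
move=> b' sigma' eta' x' _ [xL2' bL2' sL2' x0' xS'].
have coordB (f g : nat -> T -> 'rV[R]_n) k i : L2rho P F rho f ->
    L2rho P F rho g ->
    measurable_wrt (F k) (fun t => (f k t - g k t)%R ord0 i).
  move=> fL2 gL2; rewrite /measurable_wrt; under eq_fun do rewrite !mxE.
  by apply: measurable_funB; exact: coordT.
have finB (f g : nat -> T -> 'rV[R]_n) k : L2rho P F rho f ->
    L2rho P F rho g -> \int[P]_t (enorm (f k t - g k t) ^+ 2)%:E < +oo.
  move=> fL2 gL2; apply: enormB_second_moment_lty.
  - by move=> i; apply: measurable_wrt_sub (Fm k) _; exact: coordT.
  - by move=> i; apply: measurable_wrt_sub (Fm k) _; exact: coordT.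
  - exact: (L2rho_second_moment_lty (Fm k) fL2).
  - exact: (L2rho_second_moment_lty (Fm k) gL2).
(* [D = x - x'], and the source is the discrepancy of the coefficients along
   [x']: the Lipschitz bound replaces [b(k, x_k)] by [b(k, x'_k)]. *)
apply: (@weighted_second_moment_le _ _ _ _ _ F w rho L1
  (fun t => eta t - eta' t)%R (fun k t => x k t - x' k t)%R
  (fun k t => b t k (x k t) - b' t k (x' k t))%R
  (fun k t => sigma t k (x k t) - sigma' t k (x' k t))%R
  (fun k t => enorm (b t k (x' k t) - b' t k (x' k t)) ^+ 2 +
     enorm (sigma t k (x' k t) - sigma' t k (x' k t)) ^+ 2)%R) => //.
- exact: ltW.
- by move=> k i; exact: coordB.
- by move=> k i; exact: (coordB _ _ _ _ bL2 bL2').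
- by move=> k i; exact: (coordB _ _ _ _ sL2 sL2').
- by move=> k; exact: (finB _ _ _ bL2 bL2').
- by move=> k; exact: (finB _ _ _ sL2 sL2').
- by apply: filterS2 x0 x0' => t -> ->.
- move=> k; apply: filterS2 (xS k) (xS' k) => t -> ->.
  by rewrite scalerBr opprD addrACA.
- by move=> k t; rewrite addr_ge0 ?sqr_ge0.
apply: filterS2 (A_b_lipschitz Ab) (A_sigma_lipschitz Ab) => t lb ls k.
have := lipschitz_sqr_le (b' t k (x' k t)) (lb k (x k t) (x' k t)).
have := lipschitz_sqr_le (sigma' t k (x' k t)) (ls k (x k t) (x' k t)).
by lra.
Qed.
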